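(* Let $k \ge 1$ and let $p_1,\dots,p_k$ be binary tree patterns (not necessarily distinct). Define $$\mathrm{En}_{L,p_1,\dots,p_k}(x_L,x_{p_1},\dots,x_{p_k}) = \sum_{T} x_L^{\alpha_0(T)} x_{p_1}^{\alpha_1(T)}\cdots x_{p_k}^{\alpha_k(T)},$$ where the sum is over all (finite) binary trees $T$, $\alpha_0(T)$ is the number of vertices of $T$, and $\alpha_i(T)$ is the number of copies of $p_i$ in $T$ for $1\le i\le k$. Then $\mathrm{En}_{L,p_1,\dots,p_k}$ is algebraic, i.e. it satisfies a nontrivial polynomial equation whose coefficients are polynomials in $x_L, x_{p_1},\dots,x_{p_k}$.
   Context: All trees are rooted and ordered. A binary tree is a finite rooted ordered tree in which every vertex has either $0$ children (a leaf) or exactly $2$ ordered children (left and right); the single-vertex tree is a binary tree. A binary tree pattern is a binary tree $p$ whose leaves are regarded as blanks that can be filled by arbitrary binary trees. A binary tree $T$ matches the pattern $p$ at a vertex $u$ of $T$ if there is a map $\phi$ from the vertices of $p$ to the vertices of $T$ sending the root of $p$ to $u$ such that for every internal (non-leaf) vertex $w$ of $p$, $\phi(w)$ is an internal vertex of $T$ and $\phi$ sends the left (resp. right) child of $w$ to the left (resp. right) child of $\phi(w)$; leaves of $p$ may be sent to any vertex (leaf or internal) of $T$. Equivalently, the subtree of $T$ rooted at $u$ is obtained from $p$ by replacing each leaf of $p$ by some binary tree. The number of copies of $p$ in $T$ is the number of vertices $u$ of $T$ at which $T$ matches $p$. *)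

(* Defs.v *)
From HB Require Import structures.
From mathcomp Require Import all_boot all_order all_algebra.
From mathcomp Require Import mpoly.
From mathcomp Require Import boolp classical_sets functions cardinality fsbigop.

Set Implicit Arguments.
Unset Strict Implicit.
Unset Printing Implicit Defensive.

Import GRing.Theory.
Local Open Scope ring_scope.

Inductive bintree : Type := Leaf | Node (l r : bintree).

Fixpoint tree_encode (T : bintree) : GenTree.tree unit :=
  if T is Node l r then GenTree.Node 0 [:: tree_encode l; tree_encode r]
  else GenTree.Leaf tt.

Fixpoint tree_decode (t : GenTree.tree unit) : option bintree :=
  match t with
  | GenTree.Leaf _ => Some Leaf
  | GenTree.Node _ [:: l; r] =>
      if (tree_decode l, tree_decode r) is (Some l', Some r')
      then Some (Node l' r') else None
  | _ => None
  end.

Lemma tree_encodeK : pcancel tree_encode tree_decode.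
Proof. by elim=> //= l -> r ->. Qed.

HB.instance Definition _ := Countable.copy bintree (pcan_type tree_encodeK).

(* A vertex is its address: the sequence of turns on the path from the root,   *)
(* [false] for left and [true] for right.  The children of [u] are therefore   *)
(* [rcons u false] and [rcons u true].                                         *)
Fixpoint vertices (T : bintree) : seq (seq bool) :=
  [::] :: if T is Node l r
          then map (cons false) (vertices l) ++ map (cons true) (vertices r)
          else [::].

Definition internal (T : bintree) (u : seq bool) : bool :=
  (rcons u false \in vertices T) && (rcons u true \in vertices T).

Definition nvertices (T : bintree) : nat := size (vertices T).

(* A pattern is a binary tree [p] whose leaves are the blanks.  Only the values *)
(* of [phi] at the vertices of [p] matter.                                     *)
Definition matches_at (p T : bintree) (u : seq bool) : Prop :=
  exists phi : seq bool -> seq bool,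
    [/\ phi [::] = u,
        {in vertices p, forall w, phi w \in vertices T} &
        forall w, internal p w ->
          internal T (phi w) /\ forall b, phi (rcons w b) = rcons (phi w) b].

Definition copies (p T : bintree) : nat :=
  count (fun u => `[< matches_at p T u >]) (vertices T).

Lemma nil_vertices T : [::] \in vertices T.
Proof. by case: T. Qed.

Lemma cons_vertices l r b u :
  (b :: u \in vertices (Node l r)) = (u \in vertices (if b then r else l)).
Proof.
have inj c : injective (cons c : seq bool -> _) by move=> ? ? [].
have ne c s : (~~ c :: u \in map (cons c) s) = false.
  by apply/mapP => -[x _ [/eqP]]; case: c.
rewrite inE /= mem_cat; case: b.
  by rewrite (ne false) mem_map.
by rewrite (ne true) orbF mem_map.
Qed.

Lemma vertices_uniq T : uniq (vertices T).
Proof.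
have inj c : injective (cons c : seq bool -> _) by move=> ? ? [].
elim: T => //= l IHl r IHr; rewrite cat_uniq !map_inj_uniq // IHl IHr !andbT.
rewrite mem_cat negb_or; apply/andP; split.
  by apply/andP; split; apply/mapP => -[].
by apply/hasPn => _ /mapP[u _ ->]; apply/mapP => -[].
Qed.

Fixpoint matchb (p T : bintree) : bool :=
  match p, T with
  | Leaf, _ => true
  | Node p1 p2, Node l r => matchb p1 l && matchb p2 r
  | Node _ _, Leaf => false
  end.

Lemma internal_root T : internal T [::] = (T != Leaf).
Proof. by case: T => // l r; rewrite /internal !cons_vertices !nil_vertices. Qed.

Lemma internal_cons l r b u :
  internal (Node l r) (b :: u) = internal (if b then r else l) u.
Proof. by rewrite /internal !rcons_cons !cons_vertices. Qed.

Lemma matches_at_cons p l r b u :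
  matches_at p (Node l r) (b :: u) <-> matches_at p (if b then r else l) u.
Proof.
split=> -[phi [phi0 phiV phiI]]; last first.
  exists (fun w => b :: phi w); split; first by rewrite phi0.
    by move=> w /phiV; rewrite cons_vertices.
  move=> w /phiI[Iw phiw]; rewrite internal_cons; split=> // c.
  by rewrite phiw.
have phiE w : w \in vertices p -> phi w = b :: behead (phi w).
  elim/last_ind: w => [|w c IH] => [|wcp]; first by rewrite phi0.
  have wI : internal p w.
    elim: w p {phi phi0 phiV phiI IH} wcp => [|a w IH] [|p1 p2] //.
      by rewrite internal_root.
    by rewrite rcons_cons cons_vertices internal_cons => /IH.
  have wp : w \in vertices p.
    elim: w p {phi phi0 phiV phiI IH wcp} wI => [|a w IH] [|p1 p2] //.
    by rewrite internal_cons cons_vertices => /IH.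
  by have [_ ->] := phiI _ wI; rewrite {1}IH // rcons_cons /= -rcons_cons -IH // IH.
exists (fun w => behead (phi w)); split; first by rewrite phi0.
  by move=> w wp; have := phiV w wp; rewrite phiE // cons_vertices.
move=> w wI; have [Iw phiw] := phiI _ wI.
have wp : w \in vertices p.
  elim: w p {phi phi0 phiV phiI phiE Iw phiw} wI => [|a w IH] [|p1 p2] //.
  by rewrite internal_cons cons_vertices => /IH.
move: Iw; rewrite phiE // internal_cons => Iw; split=> // c.
by rewrite phiw phiE.
Qed.

Lemma matches_at_rootP p T : reflect (matches_at p T [::]) (matchb p T).
Proof.
apply: (iffP idP).
  elim: p T => [|p1 IH1 p2 IH2] T.
    move=> _; exists id; split=> // w.
      by rewrite inE => /eqP ->; exact: nil_vertices.
    by rewrite /internal /=; case: w.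
  case: T => [|l r] //= /andP[/IH1[f1 [f10 f1V f1I]] /IH2[f2 [f20 f2V f2I]]].
  exists (fun w => if w is b :: w' then b :: (if b then f2 else f1) w'
                   else [::]).
  split=> //.
    move=> [|b w]; rewrite ?nil_vertices // !cons_vertices.
    by case: b => [/f2V|/f1V].
  move=> [|b w].
    by rewrite !internal_root; split=> // -[]; rewrite /= ?f10 ?f20.
  rewrite !internal_cons; case: b => [/f2I|/f1I] [Iw fw].
    by split=> // c; rewrite rcons_cons fw.
  by split=> // c; rewrite rcons_cons fw.
elim: p T => [|p1 IH1 p2 IH2] [|l r] // [phi [phi0 phiV phiI]].
  by have [|] := phiI [::]; rewrite ?internal_root // phi0.
have [|_ phi1] := phiI [::]; first by rewrite internal_root.
have sub b : matches_at (if b then p2 else p1) (if b then r else l) [::].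
  apply/(@matches_at_cons _ l r); exists (fun w => phi (b :: w)); split.
  - by rewrite (phi1 b) phi0.
  - by move=> w wp; apply: phiV; rewrite cons_vertices.
  by move=> w wI; apply: phiI; rewrite internal_cons.
by rewrite /= IH1 ?IH2 //; [exact: (sub true) | exact: (sub false)].
Qed.

Lemma copies_Leaf p : copies p Leaf = matchb p Leaf.
Proof.
rewrite /copies /= addn0; congr nat_of_bool.
exact: (asbool_equiv_eqP (matches_at_rootP p Leaf)).
Qed.

Lemma copies_Node p l r :
  copies p (Node l r) = (matchb p (Node l r) + copies p l + copies p r)%N.
Proof.
rewrite /copies /= count_cat !count_map addnA; congr (_ + _ + _)%N.
- congr nat_of_bool.
  exact: (asbool_equiv_eqP (matches_at_rootP p (Node l r))).
- by apply: eq_count => u /=; apply: asbool_equiv_eq; exact: matches_at_cons.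
- by apply: eq_count => u /=; apply: asbool_equiv_eq; exact: matches_at_cons.
Qed.

Record fps (R : comNzRingType) (n : nat) : Type :=
  FPS { fcoef : 'X_{1.. n} -> R }.

HB.instance Definition _ R n := [isNew for @fcoef R n].
HB.instance Definition _ R n := gen_eqMixin (fps R n).
HB.instance Definition _ R n := gen_choiceMixin (fps R n).

Section FPSRing.
Variables (R : comNzRingType) (n : nat).
Implicit Types (f g h : fps R n) (m : 'X_{1.. n}).

Lemma fpsP f g : (forall m, fcoef f m = fcoef g m) -> f = g.
Proof. by case: f g => f [g] /= fg; congr FPS; apply/funext. Qed.

Definition fps_of_mpoly (P : {mpoly R[n]}) : fps R n := FPS (fun m => P@_m).

Definition fps_add f g := FPS (fun m => fcoef f m + fcoef g m).
Definition fps_opp f := FPS (fun m => - fcoef f m).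
Definition fps_mul f g :=
  FPS (fun m => \sum_(k : 'X_{1..n < (mdeg m).+1, (mdeg m).+1}
                       | m == (k.1 + k.2)%MM) fcoef f k.1 * fcoef g k.2).

Lemma fps_addA : associative fps_add.
Proof. by move=> f g h; apply: fpsP => m /=; rewrite addrA. Qed.
Lemma fps_addC : commutative fps_add.
Proof. by move=> f g; apply: fpsP => m /=; rewrite addrC. Qed.
Lemma fps_add0 : left_id (fps_of_mpoly 0) fps_add.
Proof. by move=> f; apply: fpsP => m /=; rewrite mcoeff0 add0r. Qed.
Lemma fps_addN : left_inverse (fps_of_mpoly 0) fps_opp fps_add.
Proof. by move=> f; apply: fpsP => m /=; rewrite mcoeff0 addNr. Qed.

HB.instance Definition _ := GRing.isZmodule.Build (fps R n)
  fps_addA fps_addC fps_add0 fps_addN.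

Definition fps_trunc (d : nat) f : {mpoly R[n]} :=
  \sum_(m : 'X_{1..n < d}) fcoef f m *: 'X_[m].

Lemma fps_truncE d f m : (mdeg m < d)%N -> (fps_trunc d f)@_m = fcoef f m.
Proof.
move=> md; rewrite raddf_sum (bigD1 (BMultinom md)) //=.
rewrite mcoeffZ mcoeffX eqxx mulr1 big1 ?addr0 // => k kNm.
rewrite mcoeffZ mcoeffX; case: eqP => [km|_]; last by rewrite mulr0.
by case/eqP: kNm; apply: val_inj.
Qed.

Lemma fps_mul_mpoly (d : nat) f g (P Q : {mpoly R[n]}) m : (mdeg m < d)%N ->
  (forall k, (mdeg k < d)%N -> P@_k = fcoef f k) ->
  (forall k, (mdeg k < d)%N -> Q@_k = fcoef g k) ->
  fcoef (fps_mul f g) m = (P * Q)@_m.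
Proof.
move=> md fP gQ; rewrite mcoeffM /=; apply: eq_bigr => k _.
by rewrite fP ?gQ //; apply: (leq_trans (bmdeg _)).
Qed.

Lemma fps_mulE (d : nat) f g m : (mdeg m < d)%N ->
  fcoef (fps_mul f g) m = (fps_trunc d f * fps_trunc d g)@_m.
Proof. by move=> md; apply: (fps_mul_mpoly md) => k; exact: fps_truncE. Qed.

Lemma fps_mulA : associative fps_mul.
Proof.
move=> f g h; apply: fpsP => m; have md := ltnSn (mdeg m).
rewrite (fps_mul_mpoly (P := fps_trunc (mdeg m).+1 f)
  (Q := fps_trunc (mdeg m).+1 g * fps_trunc (mdeg m).+1 h) md).
- rewrite (fps_mul_mpoly (Q := fps_trunc (mdeg m).+1 h)
    (P := fps_trunc (mdeg m).+1 f * fps_trunc (mdeg m).+1 g) md) ?mulrA //.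
  + by move=> k kd; rewrite (fps_mulE _ _ kd).
  + by move=> k; exact: fps_truncE.
- by move=> k; exact: fps_truncE.
- by move=> k kd; rewrite (fps_mulE _ _ kd).
Qed.

Lemma fps_mulC : commutative fps_mul.
Proof.
move=> f g; apply: fpsP => m.
by rewrite !(fps_mulE _ _ (ltnSn _)) mulrC.
Qed.

Lemma fps_mul1 : left_id (fps_of_mpoly 1) fps_mul.
Proof.
move=> f; apply: fpsP => m.
rewrite (fps_mul_mpoly (P := 1) (Q := fps_trunc (mdeg m).+1 f) (ltnSn _)) //.
  by rewrite mul1r fps_truncE.
by move=> k; exact: fps_truncE.
Qed.

Lemma fps_mulDl : left_distributive fps_mul fps_add.
Proof.
move=> f g h; apply: fpsP => m /=; rewrite -big_split /=.
by apply: eq_bigr => k _; rewrite mulrDl.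
Qed.

Lemma fps_1_neq0 : fps_of_mpoly 1 != 0 :> fps R n.
Proof.
apply/eqP => /(congr1 (fun f => fcoef f 0%MM)) /=.
by rewrite mcoeff1 eqxx mcoeff0 => /eqP; rewrite oner_eq0.
Qed.

HB.instance Definition _ := GRing.Zmodule_isComNzRing.Build (fps R n)
  fps_mulA fps_mulC fps_mul1 fps_mulDl fps_1_neq0.

Lemma fps_of_mpoly_is_zmod_morphism : zmod_morphism fps_of_mpoly.
Proof. by move=> P Q; apply: fpsP => m /=; rewrite mcoeffB. Qed.

Lemma fps_of_mpoly_is_monoid_morphism : monoid_morphism fps_of_mpoly.
Proof. by split=> // P Q; apply: fpsP => m /=; rewrite mcoeffM. Qed.

HB.instance Definition _ :=
  GRing.isZmodMorphism.Build {mpoly R[n]} (fps R n) fps_of_mpoly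
    fps_of_mpoly_is_zmod_morphism.
HB.instance Definition _ :=
  GRing.isMonoidMorphism.Build {mpoly R[n]} (fps R n) fps_of_mpoly
    fps_of_mpoly_is_monoid_morphism.

(* Sum of a family of power series, coefficient by coefficient.  The sum       *)
(* [\sum_(i \in A) _] ranges over the indices with a nonzero term and is 0 by  *)
(* convention if there are infinitely many of them, hence the intended use is  *)
(* for families that satisfy [fps_summable].                                   *)
Definition fps_sum (I : choiceType) (F : I -> fps R n) : fps R n :=
  FPS (fun m => \sum_(i \in [set: I]) fcoef (F i) m).

Definition fps_summable (I : choiceType) (F : I -> fps R n) : Prop :=
  forall m, finite_set [set i | fcoef (F i) m != 0].

Definition fps_var (i : 'I_n) : fps R n := fps_of_mpoly 'X_i.

Definition fps_algebraic (f : fps R n) : Prop :=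
  exists2 P : {poly {mpoly R[n]}},
    P != 0 & root (map_poly fps_of_mpoly P) f.

Lemma fcoef_mpoly P m : fcoef (fps_of_mpoly P) m = P@_m.
Proof. by []. Qed.

Lemma fcoef_sum (I : choiceType) (F : I -> fps R n) m :
  fcoef (fps_sum F) m = \sum_(i \in [set: I]) fcoef (F i) m.
Proof. by []. Qed.

End FPSRing.

Arguments fcoef {R n} _ _ : simpl never.

(* Variable [ord0] is x_L; variable [lift ord0 i] is x_{p_i}. *)
Definition tree_term (k : nat) (p : 'I_k -> bintree) (T : bintree) :
    fps rat k.+1 :=
  fps_var rat ord0 ^+ nvertices T *
  \prod_(i < k) fps_var rat (lift ord0 i) ^+ copies (p i) T.

Definition En (k : nat) (p : 'I_k -> bintree) : fps rat k.+1 :=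
  fps_sum (tree_term p).

Lemma tree_termE k (p : 'I_k -> bintree) T m :
  fcoef (tree_term p T) m =
  ((m == [multinom oapp (fun i => copies (p i) T) (nvertices T)
                        (unlift ord0 j) | j < k.+1])%:R : rat).
Proof.
have -> : tree_term p T = fps_of_mpoly ('X_ord0 ^+ nvertices T *
    \prod_(i < k) 'X_(lift ord0 i) ^+ copies (p i) T).
  rewrite rmorphM rmorph_prod rmorphXn; congr (_ * _).
  by apply: eq_bigr => i _; rewrite rmorphXn.
rewrite fcoef_mpoly eq_sym -mcoeffX [in RHS]mpolyXE_id big_ord_recl.
rewrite mnmE unlift_none; congr (mcoeff m (_ * _)).
by apply: eq_bigr => i _; rewrite mnmE liftK.
Qed.

Fixpoint trees_upto (d : nat) : seq bintree :=
  if d is d'.+1 then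
    Leaf :: [seq Node l r | l <- trees_upto d', r <- trees_upto d']
  else [::].

Lemma mem_trees_upto d T : (nvertices T <= d)%N -> T \in trees_upto d.
Proof.
elim: d T => [|d IH] [|l r] //=; rewrite /nvertices /= size_cat !size_map ltnS.
move=> lrd; rewrite inE /=; apply: allpairs_f; apply: IH.
  exact: leq_trans (leq_addr _ _) lrd.
exact: leq_trans (leq_addl _ _) lrd.
Qed.

Lemma tree_term_summable k (p : 'I_k -> bintree) : fps_summable (tree_term p).
Proof.
move=> m; apply: (@sub_finite_set _ _ [set` trees_upto (m ord0)]) => [T|].
  rewrite /= tree_termE; case: (m =P _) => [-> _|_]; last by rewrite eqxx.
  by rewrite mnmE unlift_none; exact: mem_trees_upto.
exact: finite_seq.
Qed.

Lemma En_coef k (p : 'I_k -> bintree) (d : nat) (m : 'X_{1.. k.+1}) :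
  (m ord0 <= d)%N ->
  fcoef (En p) m = \sum_(T <- undup (trees_upto d)) fcoef (tree_term p T) m.
Proof.
move=> md; rewrite fcoef_sum (fsbigE (undup (trees_upto d))) ?undup_uniq //=.
  by apply: eq_bigl => T; rewrite in_setT.
move=> T _; rewrite mem_undup => TN; rewrite tree_termE; case: (m =P _) => // mE.
case/negP: TN; apply/mem_trees_upto.
by move: md; rewrite mE mnmE unlift_none.
Qed.

(* Main.v *)
(* Only the pruning of a tree at the maximal height of the patterns matters for *)
(* the matches at its root, so the trees split into finitely many states s, and *)
(* their generating functions satisfy y_s = x_L w_s ([s = s0] + sum y_t y_u).   *)
(* Such a system need not define a zero-dimensional variety, so it is deformed  *)
(* by adding e x_L y_s^3 to each equation, with e a new variable.  The deformed *)
(* system still has a power series solution, with coefficients in Q[e].  Once   *)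
(* e x_L is inverted, it rewrites y_s^3 in lower degree, hence the finitely     *)
(* many monomials with all exponents at most 2 span the algebra generated by    *)
(* the solution, and the determinant trick makes sum y_s a root of a nonzero    *)
(* polynomial over Q[x][e].  Dividing this polynomial by the largest possible   *)
(* power of e and setting e = 0 gives an equation for En.                       *)
From HB Require Import structures.
Require Import Defs.
From mathcomp Require Import all_boot all_order all_algebra.
From mathcomp Require Import mpoly boolp.

Set Implicit Arguments.
Unset Strict Implicit.
Unset Printing Implicit Defensive.

Import GRing.Theory.
Local Open Scope ring_scope.

(** Let d be the largest pattern height. The class [prune d T] decides which patterns match at the
    root of [T], and the class of a node depends only on those of its two children. Hence En is a
    sum of finitely many series solving a quadratic system ([En_tree_system]). The deformed system
    makes cubes reducible, so that up to powers of x_L e finitely many monomials span everything and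
    the sum is integral ([tree_system_sum_integral]). Its equation survives at e = 0 because e is
    regular and can be divided out beforehand ([fps_algebraic_at0]). *)

(** * Integrality from reducible cubes *)

Section Integrality.
Variables (C A : comNzRingType) (iota : {rmorphism C -> A}).

(** Determinant trick: [z] minus the matrix [M] kills the column of the [v i], hence so does its
    determinant. As 1 is among the [v i], the determinant vanishes even if [A] has zero divisors. *)
Lemma integral_of_stable_family (I : finType) (v : I -> A) (i0 : I)
    (M : I -> I -> C) (z : A) :
  v i0 = 1 -> (forall i, z * v i = \sum_j iota (M i j) * v j) ->
  integralOver iota z.
Proof.
move=> v1 zv; pose X := \matrix_(i < #|I|, j < #|I|) M (enum_val i) (enum_val j).
exists (char_poly X); first exact: char_poly_monic.
pose w := \col_(i < #|I|) v (enum_val i).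
pose Y := z%:M - map_mx iota X.
have Yw : Y *m w = 0.
  apply/colP=> i; rewrite mulmxBl mul_scalar_mx !mxE zv.
  rewrite (eq_bigl (mem I)) // big_enum_val -sumrB big1 // => j _.
  by rewrite !mxE subrr.
have detY : \det Y = 0.
  have /(congr1 (fun B : 'cV_ _ => B (enum_rank i0) 0)) : \adj Y *m (Y *m w) = 0.
    by rewrite Yw mulmx0.
  by rewrite mulmxA mul_adj_mx mul_scalar_mx !mxE enum_rankK v1 mulr1.
rewrite /root map_char_poly -detY -[_.[z]]/(horner_eval z _) -det_map_mx.
apply/eqP; congr (\det _); apply/matrixP=> i j.
by rewrite !mxE /= /horner_eval hornerD hornerN hornerMn hornerX hornerC.
Qed.

Variables (S : finType) (c : C) (y : S -> A).

Let box_monomial (e : {ffun S -> 'I_3}) : A := \prod_s y s ^+ e s.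

(* The monomials in [y] with all exponents at most 2 span [u] after inverting  *)
(* [iota c].                                                                   *)
Definition box_spanned (u : A) : Prop :=
  exists N (g : {ffun S -> 'I_3} -> C),
    iota c ^+ N * u = \sum_e iota (g e) * box_monomial e.

Lemma box_spannedD u v : box_spanned u -> box_spanned v -> box_spanned (u + v).
Proof.
move=> [N [g ug]] [N' [g' vg]].
exists (N + N')%N, (fun e => c ^+ N' * g e + c ^+ N * g' e).
rewrite mulrDr exprD {1}[iota c ^+ N * _]mulrC -!mulrA ug vg !mulr_sumr -big_split.
by apply: eq_bigr => e _; rewrite rmorphD !rmorphM !rmorphXn mulrDl !mulrA.
Qed.

Lemma box_spannedZ a u : box_spanned u -> box_spanned (iota a * u).
Proof.
move=> [N [g ug]]; exists N, (fun e => a * g e).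
by rewrite mulrCA ug mulr_sumr; apply: eq_bigr => e _; rewrite rmorphM mulrA.
Qed.

Lemma box_spanned0 : box_spanned 0.
Proof.
by exists 0, (fun=> 0); rewrite mulr0 big1 // => e _; rewrite rmorph0 mul0r.
Qed.

Lemma box_spannedB u v : box_spanned u -> box_spanned v -> box_spanned (u - v).
Proof.
by move=> su /(box_spannedZ (-1)); rewrite rmorphN1 mulN1r; exact: box_spannedD.
Qed.

Lemma box_spanned_sum (I : Type) (r : seq I) (P : pred I) (F : I -> A) :
  (forall i, P i -> box_spanned (F i)) -> box_spanned (\sum_(i <- r | P i) F i).
Proof. by move=> PF; elim/big_ind: _ => //; [exact: box_spanned0|exact: box_spannedD]. Qed.

Lemma box_spanned_denom u : box_spanned (iota c * u) -> box_spanned u.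
Proof. by move=> [N [g ug]]; exists N.+1, g; rewrite exprSr -mulrA. Qed.

Variables (a : S -> C) (b : S -> S -> S -> C).
Hypothesis y_sys : forall s,
  y s = iota (a s) + \sum_t \sum_u iota (b s t u) * (y t * y u) + iota c * y s ^+ 3.

(** Induction on the degree: an exponent of at least 3 supplies a cube, and [y_sys] turns [iota c]
    times this cube into terms of degree at most 2. *)
Lemma box_spanned_monomial (l : seq S) : box_spanned (\prod_(s <- l) y s).
Proof.
have [n] := ubnP (size l); elim: n l => // n IH l.
case: (boolP [forall s, count_mem s l < 3]%N) => [/forallP l3 _|].
  (* Already a box monomial; [inord] is faithful since all multiplicities are below 3. *)
  exists 0, (fun e => (e == [ffun s => inord (count_mem s l)])%:R).
  rewrite mul1r (bigD1 [ffun s => inord (count_mem s l)]) //= eqxx rmorph1 mul1r.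
  rewrite [X in _ + X]big1 => [|e /negPf ->]; last by rewrite rmorph0 mul0r.
  rewrite addr0 /box_monomial -big_undup_iterop_count /=.
  rewrite [RHS](bigID (mem (undup l))) /= [X in _ * X]big1 ?mulr1 => [|s]; last first.
    by rewrite mem_undup ffunE => /count_memPn ->; rewrite inordK.
  rewrite -big_uniq ?undup_uniq //=; apply: eq_bigr => s _.
  by rewrite ffunE inordK // /GRing.exp.
rewrite negb_forall => /existsP[s]; rewrite -leqNgt => s3 ln.
have [l' ll'] : exists l', perm_eq l [:: s, s, s & l'].
  exists (nseq (count_mem s l - 3) s ++ filter (predC1 s) l).
  have /all_pred1P lE : all (pred1 s) (filter (pred1 s) l) by exact: filter_all.
  rewrite -(perm_filterC (pred1 s) l) lE size_filter.
  by rewrite -{1}(subnKC s3).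
rewrite (perm_big _ ll') !big_cons; apply: box_spanned_denom.
have -> : iota c * (y s * (y s * (y s * \prod_(t <- l') y t))) =
    y s * \prod_(t <- l') y t - iota (a s) * \prod_(t <- l') y t -
    \sum_t \sum_u iota (b s t u) * (y t * (y u * \prod_(t <- l') y t)).
  have <- : (\sum_t \sum_u iota (b s t u) * (y t * y u)) * \prod_(t <- l') y t =
      \sum_t \sum_u iota (b s t u) * (y t * (y u * \prod_(t <- l') y t)).
    rewrite mulr_suml; apply: eq_bigr => t _; rewrite mulr_suml.
    by apply: eq_bigr => u _; rewrite -!mulrA.
  rewrite -!mulrBl {4}y_sys -addrA -opprD addrC addKr.
  by rewrite exprS expr2 -!mulrA.
have yE t r : y t * \prod_(u <- r) y u = \prod_(u <- t :: r) y u by rewrite big_cons.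
have lt_size (r : seq S) : (size r <= (size l').+2)%N -> (size r < n)%N.
  by move=> rl'; move: ln; rewrite ltnS; apply: leq_trans; rewrite (perm_size ll').
apply: box_spannedB.
  apply: box_spannedB; first by rewrite yE; apply/IH/lt_size/leqnSn.
  by apply/box_spannedZ/IH/lt_size/leqW/leqnSn.
apply: box_spanned_sum => t _; apply: box_spanned_sum => u _.
by apply: box_spannedZ; rewrite !yE; apply/IH/lt_size/leqnn.
Qed.

(** Each box monomial times the sum needs its own power of [c] to land in the span. The total of
    these exponents serves all of them, and the box monomials, which include 1, become a stable
    family. *)
Lemma sum_integral_up_to_denom :
  exists N, integralOver iota (iota c ^+ N * \sum_s y s).
Proof.
have box_sum e : box_spanned ((\sum_s y s) * box_monomial e).
  rewrite mulr_suml; apply: box_spanned_sum => s _.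
  pose l := s :: flatten [seq nseq (e t) t | t <- index_enum S].
  suff <- : \prod_(t <- l) y t = y s * box_monomial e.
    exact: box_spanned_monomial.
  rewrite big_cons big_flatten big_map; congr (_ * _).
  by apply: eq_bigr => t _; rewrite big_nseq -Monoid.iteropE.
have [f fP] := choice box_sum.
have [g gP] := choice fP.
exists (\sum_e f e)%N.
apply: (@integral_of_stable_family _ box_monomial [ffun=> ord0]
  (fun e e' => c ^+ (\sum_(e1 | e1 != e) f e1) * g e e')) => [|e].
  by rewrite /box_monomial big1 // => s _; rewrite ffunE.
rewrite (bigD1 e) //= exprD.
have -> : iota c ^+ f e * iota c ^+ (\sum_(i | i != e) f i) * (\sum_s y s) * box_monomial e
 = iota c ^+ (\sum_(i | i != e) f i) * (iota c ^+ f e * ((\sum_s y s) * box_monomial e)).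
  by rewrite -!mulrA mulrCA.
rewrite gP mulr_sumr; apply: eq_bigr => e' _.
by rewrite rmorphM rmorphXn mulrA.
Qed.


End Integrality.

(** * Coefficients of series and change of coefficient ring *)

Section Coefficients.
Variables (R : comNzRingType) (n : nat).
Implicit Types (f g : fps R n) (m : 'X_{1.. n}).

Lemma fcoefD f g m : fcoef (f + g) m = fcoef f m + fcoef g m.
Proof. by []. Qed.

Lemma fcoefB f g m : fcoef (f - g) m = fcoef f m - fcoef g m.
Proof. by []. Qed.

Lemma fcoefM f g m : fcoef (f * g) m =
  \sum_(k : 'X_{1..n < (mdeg m).+1, (mdeg m).+1} | m == (k.1 + k.2)%MM)
    fcoef f k.1 * fcoef g k.2.
Proof. by []. Qed.

Lemma fcoef1 m : fcoef (1 : fps R n) m = (m == 0%MM)%:R.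
Proof. exact: mcoeff1. Qed.

Lemma fcoef0 m : fcoef (0 : fps R n) m = 0.
Proof. exact: mcoeff0. Qed.

Lemma fcoef_bigsum (I : Type) (r : seq I) (F : I -> fps R n) m :
  fcoef (\sum_(i <- r) F i) m = \sum_(i <- r) fcoef (F i) m.
Proof. by apply: (big_morph (fcoef^~ m)) => [f g|]; rewrite ?fcoef0. Qed.

Lemma fcoef_var0 (i : 'I_n) : fcoef (fps_var R i) 0%MM = 0.
Proof.
rewrite fcoef_mpoly mcoeffX; case: eqP => [/(congr1 mdeg)|//].
by rewrite mdeg1 mdeg0.
Qed.

End Coefficients.

Section FpsMap.
Variables (R R' : comNzRingType) (n : nat) (phi : {rmorphism R -> R'}).

Definition fps_map (f : fps R n) : fps R' n := FPS (fun m => phi (fcoef f m)).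

Lemma fcoef_map f m : fcoef (fps_map f) m = phi (fcoef f m).
Proof. by []. Qed.

Lemma fps_map_is_zmod_morphism : zmod_morphism fps_map.
Proof. by move=> f g; apply: fpsP => m; rewrite !(fcoefB, fcoef_map) rmorphB. Qed.

Lemma fps_map_is_monoid_morphism : monoid_morphism fps_map.
Proof.
split=> [|f g]; apply: fpsP => m; first by rewrite fcoef_map !fcoef1 rmorph_nat.
rewrite !(fcoefM, fcoef_map) rmorph_sum.
by apply: eq_bigr => k _; rewrite rmorphM.
Qed.

HB.instance Definition _ :=
  GRing.isZmodMorphism.Build (fps R n) (fps R' n) fps_map
    fps_map_is_zmod_morphism.
HB.instance Definition _ :=
  GRing.isMonoidMorphism.Build (fps R n) (fps R' n) fps_map
    fps_map_is_monoid_morphism.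

Lemma fps_map_mpoly (P : {mpoly R[n]}) :
  fps_map (fps_of_mpoly P) = fps_of_mpoly (map_mpoly phi P).
Proof. by apply: fpsP => m; rewrite fcoef_mpoly mcoeff_map_mpoly. Qed.

End FpsMap.

(** * Fixed points of contractions on power series *)

Section Congruence.
Variables (R : comNzRingType) (n : nat).
Implicit Types (f g u : fps R n) (d : nat).

Definition fps_eqmod d f g : Prop :=
  forall m, (mdeg m < d)%N -> fcoef f m = fcoef g m.

Lemma fps_eqmodD d f g f' g' :
  fps_eqmod d f f' -> fps_eqmod d g g' -> fps_eqmod d (f + g) (f' + g').
Proof. by move=> ff gg m md; rewrite !fcoefD ff ?gg. Qed.

Lemma fps_eqmodM d f g f' g' :
  fps_eqmod d f f' -> fps_eqmod d g g' -> fps_eqmod d (f * g) (f' * g').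
Proof.
move=> ff gg m md; rewrite !fcoefM; apply: eq_bigr => k _.
by rewrite ff ?gg //; apply: (leq_trans (bmdeg _)).
Qed.

Lemma fps_eqmodX d f g k : fps_eqmod d f g -> fps_eqmod d (f ^+ k) (g ^+ k).
Proof. by move=> fg; elim: k => // k IH; rewrite !exprS; exact: fps_eqmodM. Qed.

Lemma fps_eqmod_sum d (I : Type) (r : seq I) (F G : I -> fps R n) :
  (forall i, fps_eqmod d (F i) (G i)) ->
  fps_eqmod d (\sum_(i <- r) F i) (\sum_(i <- r) G i).
Proof.
by move=> FG; elim/big_ind2: _ => // f f' g g'; exact: fps_eqmodD.
Qed.

(** Without a constant term in [u], coefficients of degree at most [d] in [u * f] involve only those
    of [f] of degree below [d]. *)
Lemma fps_eqmod_mul_gain d u f g :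
  fcoef u 0%MM = 0 -> fps_eqmod d f g -> fps_eqmod d.+1 (u * f) (u * g).
Proof.
move=> u0 fg m; rewrite ltnS => md; rewrite !fcoefM.
apply: eq_bigr => k /eqP mk.
have [->|k0] := eqVneq (k.1 : 'X_{1.. n}) 0%MM; first by rewrite u0 !mul0r.
rewrite fg //; apply: leq_trans md; rewrite [ltnRHS](congr1 mdeg mk) mdegD.
by rewrite -[X in (X < _)%N]add0n ltn_add2r lt0n mdeg_eq0.
Qed.

Variables (S : finType) (F : (S -> fps R n) -> S -> fps R n).

(** Limit of the iterates from 0: for a contracting [F], the coefficient at [m] is stable from
    iterate [(mdeg m).+1] on. *)
Definition fps_fix (s : S) : fps R n :=
  FPS (fun m => fcoef (iter (mdeg m).+1 F (fun=> 0) s) m).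

Hypothesis F_contracts : forall d Y Y', (forall s, fps_eqmod d (Y s) (Y' s)) ->
  forall s, fps_eqmod d.+1 (F Y s) (F Y' s).

Lemma fps_fix_eqmod d s : fps_eqmod d (fps_fix s) (iter d F (fun=> 0) s).
Proof.
have iterD e k : forall t, fps_eqmod e (iter e F (fun=> 0) t)
    (iter (e + k) F (fun=> 0) t).
  by elim: e => // e IH t; rewrite addSn !iterS; apply: F_contracts.
by move=> m md; rewrite -(subnKC md); exact: (iterD _ _ _ m (ltnSn _)).
Qed.

Lemma fps_fixE s : fps_fix s = F fps_fix s.
Proof.
apply: fpsP => m; rewrite {1}/fcoef /=; apply/esym.
by apply: F_contracts (ltnSn _) => t; exact: fps_fix_eqmod.
Qed.

End Congruence.

Lemma fps_map_fix (R R' : comNzRingType) n (phi : {rmorphism R -> R'})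
    (S : finType) (F : (S -> fps R n) -> S -> fps R n)
    (F' : (S -> fps R' n) -> S -> fps R' n) s :
  (forall d, fps_map phi (iter d F (fun=> 0) s) = iter d F' (fun=> 0) s) ->
  fps_map phi (fps_fix F s) = fps_fix F' s.
Proof.
by move=> FF'; apply: fpsP => m; rewrite [RHS]/fcoef /= -/(iter _.+1 _ _) -FF'.
Qed.

(** * The deformed tree system *)

Section System.
Variables (S : finType) (s0 : S) (delta : S -> S -> S).

(* The undeformed system of the trees is the case [e = 0].                     *)
Definition tree_system (A : comNzRingType) (x e : A) (w : S -> A) (Y : S -> A)
    (s : S) : A :=
  x * (w s * ((s == s0)%:R + \sum_t \sum_u (delta t u == s)%:R * (Y t * Y u))
       + e * Y s ^+ 3).

Lemma rmorph_tree_system (A B : comNzRingType) (phi : {rmorphism A -> B})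
    x e w Y s :
  phi (tree_system x e w Y s) =
  tree_system (phi x) (phi e) (phi \o w) (phi \o Y) s.
Proof.
rewrite /tree_system !(rmorphM, rmorphD, rmorphXn, rmorph_nat) /=.
congr (_ * (_ * (_ + _) + _)); rewrite rmorph_sum; apply: eq_bigr => t _.
by rewrite rmorph_sum; apply: eq_bigr => u _; rewrite !rmorphM rmorph_nat.
Qed.

Lemma rmorph_iter_tree_system (A B : comNzRingType) (phi : {rmorphism A -> B})
    x e w d s :
  phi (iter d (tree_system x e w) (fun=> 0) s) =
  iter d (tree_system (phi x) (phi e) (phi \o w)) (fun=> 0) s.
Proof.
elim: d s => [|d IH] s /=; first by rewrite rmorph0.
by rewrite rmorph_tree_system; congr tree_system; apply/funext => t /=.
Qed.

Lemma tree_system_contracts (R : comNzRingType) n (x e : fps R n) w :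
  fcoef x 0%MM = 0 ->
  forall d Y Y', (forall s, fps_eqmod d (Y s) (Y' s)) ->
  forall s, fps_eqmod d.+1 (tree_system x e w Y s) (tree_system x e w Y' s).
Proof.
move=> x0 d Y Y' YY s; apply: fps_eqmod_mul_gain => //.
apply: fps_eqmodD; last by apply: fps_eqmodM => //; exact: fps_eqmodX.
apply: fps_eqmodM => //; apply: fps_eqmodD => //.
apply: fps_eqmod_sum => t; apply: fps_eqmod_sum => u.
by apply: fps_eqmodM => //; exact: fps_eqmodM.
Qed.

Lemma tree_system_sum_integral (C A : comNzRingType) (iota : {rmorphism C -> A})
    x e w (y : S -> A) :
  (forall s, y s = tree_system (iota x) (iota e) (iota \o w) y s) ->
  exists N, integralOver iota (iota (x * e) ^+ N * \sum_s y s).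
Proof.
move=> yE; apply: (@sum_integral_up_to_denom _ _ _ _ _ _
  (fun s => x * w s * (s == s0)%:R)
  (fun s t u => x * w s * (delta t u == s)%:R)) => s.
rewrite {1}yE /tree_system mulrDr mulrA mulrDr !rmorphM rmorph_nat !mulrA.
congr (_ + _ + _); rewrite mulr_sumr; apply: eq_bigr => t _.
rewrite mulr_sumr; apply: eq_bigr => u _.
by rewrite !rmorphM rmorph_nat !mulrA.
Qed.

End System.

(** * Setting the deformation parameter to zero *)

Section Specialization.
Variables (R : idomainType) (n : nat).

(** The parameter e lives in the coefficients, as the variable of [{poly R}], so that e = 0 is a
    coefficientwise morphism [at0]. In the equations it is the variable of [{poly {mpoly R[n]}}],
    which [iota] sends to [eps]. *)
Let lift : {rmorphism {mpoly R[n]} -> fps {poly R} n} :=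
  fps_map polyC \o @fps_of_mpoly R n.
Let eps : fps {poly R} n := fps_of_mpoly ('X%:MP).
Let iota : {rmorphism {poly {mpoly R[n]}} -> fps {poly R} n} :=
  horner_eval eps \o map_poly lift.
Let at0 : {rmorphism fps {poly R} n -> fps R n} :=
  fps_map (horner_eval (0 : R)).

Lemma at0_lift P : at0 (lift P) = fps_of_mpoly P.
Proof. by apply: fpsP => m; rewrite /fcoef /= /fcoef /= /horner_eval hornerC. Qed.

Lemma at0_eps : at0 eps = 0.
Proof.
rewrite /at0 /= fps_map_mpoly map_mpolyC /= /horner_eval hornerX.
by rewrite mpolyC0 rmorph0.
Qed.

Lemma eps_lreg : GRing.lreg eps.
Proof.
apply: GRing.mulrI0_lreg => f epsf; apply: fpsP => m.
have : fcoef (eps * f) m = 'X * fcoef f m.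
  rewrite [LHS](fps_mul_mpoly (P := 'X%:MP) (Q := fps_trunc (mdeg m).+1 f) (ltnSn _)) //.
    by rewrite mcoeffCM fps_truncE.
  by move=> k; exact: fps_truncE.
by rewrite epsf => /esym/eqP; rewrite fcoef0 mulf_eq0 polyX_eq0 => /eqP ->.
Qed.

Lemma fps_algebraic_at0 (P : {poly {poly {mpoly R[n]}}}) (z : fps {poly R} n) :
  P != 0 -> root (map_poly iota P) z -> fps_algebraic (at0 z).
Proof.
move=> P0 Pz.
pose psi : {rmorphism {poly {poly {mpoly R[n]}}} -> fps {poly R} n} :=
  horner_eval eps \o map_poly (horner_eval z \o map_poly lift).
have psi_swap : psi (swapXY P) = 0.
  rewrite /psi /= map_poly_comp -swapXY_map /horner_eval -horner_polyC.
  rewrite -[LHS]/(map_poly (map_poly lift) P).[z, eps] -horner2_swapXY.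
  by rewrite horner_swapXY -map_poly_comp; exact/eqP.
(* After the swap e is the outer variable: factor out e^v, leaving [Q] with [Q.[0]] nonzero. *)
have [v [Q]] := multiplicity_XsubC (swapXY P) 0.
rewrite swapXY_eq0 P0 /= subr0 => Q0 PQ.
exists Q.[0]; first by rewrite -rootE.
have psiQ : psi Q = 0.
  have psiX : psi 'X = eps by rewrite /psi /= map_polyX /horner_eval hornerX.
  move: psi_swap; rewrite PQ rmorphM rmorphXn psiX mulrC => /eqP.
  by rewrite mulrI_eq0 => [/eqP|]; last exact: GRing.lregX eps_lreg.
apply/eqP; transitivity (at0 (psi Q)); last by rewrite psiQ rmorph0.
transitivity (map_poly at0
    (map_poly (horner_eval z \o map_poly lift) Q)).[at0 eps]; last exact: horner_map.
rewrite at0_eps !horner_coef0 !coef_map.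
rewrite -[RHS]/(at0 (map_poly lift Q`_0).[z]) -horner_map -map_poly_comp.
congr _.[_]; apply: eq_map_poly => c /=.
exact/esym/at0_lift.
Qed.

Lemma fps_algebraic_tree_system (S : finType) (s0 : S) (delta : S -> S -> S)
    (i : 'I_n) (w : S -> {mpoly R[n]}) :
  fps_algebraic (\sum_s fps_fix
    (tree_system s0 delta (fps_var R i) 0 (fun t => fps_of_mpoly (w t))) s).
Proof.
have lift_var0 : fcoef (lift 'X_i) 0%MM = 0.
  by rewrite fcoef_map fcoef_var0 rmorph0.
pose y := fps_fix (tree_system s0 delta (lift 'X_i) eps (lift \o w)).
have iotaC P : iota P%:P = lift P by rewrite /iota /= map_polyC /horner_eval hornerC.
have iotaX : iota 'X = eps by rewrite /iota /= map_polyX /horner_eval hornerX.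
have yE s : y s = tree_system s0 delta (iota ('X_i)%:P) (iota 'X)
    (iota \o (fun t => (w t)%:P)) y s.
  rewrite iotaC iotaX {1}/y fps_fixE; last exact: tree_system_contracts.
  by congr tree_system; apply/funext => t; exact/esym/iotaC.
have [N [P Pmonic Py]] := tree_system_sum_integral yE.
set c := ('X_i)%:P * 'X in Py.
have c0 : c != 0.
  rewrite mulf_eq0 polyX_eq0 orbF polyC_eq0; apply/eqP => /(congr1 (mcoeff U_(i))).
  by rewrite mcoeffXU eqxx mcoeff0 => /eqP; rewrite oner_eq0.
have -> : \sum_s fps_fix (tree_system s0 delta (fps_var R i) 0
    (fun t => fps_of_mpoly (w t))) s = at0 (\sum_s y s).
  rewrite rmorph_sum; apply: eq_bigr => s _; apply/esym/fps_map_fix => d.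
  rewrite (rmorph_iter_tree_system _ _ at0) at0_eps at0_lift.
  suff -> : at0 \o (lift \o w) = fun t => fps_of_mpoly (w t) by [].
  by apply/funext => t; exact: at0_lift.
(* Turns the equation of [c ^+ N] times the sum into one of the sum; it stays nonzero because a
   nonconstant polynomial over a domain is substituted. *)
apply: (@fps_algebraic_at0 (P \Po ((c ^+ N)%:P * 'X))).
  rewrite comp_poly_eq0 ?monic_neq0 //.
  by rewrite size_mulX ?size_polyC ?expf_neq0 // polyC_eq0 expf_neq0.
rewrite -rmorphXn in Py.
rewrite map_comp_poly rmorphM /= map_polyC map_polyX rootE horner_comp.
by rewrite hornerM hornerX hornerC.
Qed.

End Specialization.

(** * Pruned trees as states *)

Fixpoint prune (d : nat) (T : bintree) : bintree :=
  match d, T with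
  | d'.+1, Node l r => Node (prune d' l) (prune d' r)
  | _, _ => Leaf
  end.

Fixpoint height (T : bintree) : nat :=
  if T is Node l r then (maxn (height l) (height r)).+1 else 0.

Lemma prune_prune d e T : (d <= e)%N -> prune d (prune e T) = prune d T.
Proof.
by elim: d e T => [|d IH] [|e] [|l r] //= de; rewrite !IH.
Qed.

Lemma prune_Node d l r : prune d (Node (prune d l) (prune d r)) = prune d (Node l r).
Proof. by case: d => // d; congr Node; exact: prune_prune. Qed.

Lemma mem_prune d T : prune d T \in trees_upto d.+1.
Proof.
elim: d T => [|d IH] [|l r] //.
change (Node (prune d l) (prune d r) \in trees_upto d.+2).
by rewrite in_cons; exact: (allpairs_f Node (IH l) (IH r)).
Qed.

Lemma matchb_prune d p T : (height p <= d)%N -> matchb p (prune d T) = matchb p T.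
Proof.
elim: p d T => [|p1 IH1 p2 IH2] [|d] [|l r] //=; rewrite ltnS geq_max => /andP[h1 h2].
by rewrite IH1 ?IH2.
Qed.

Lemma trees_upto_uniq d : uniq (trees_upto d).
Proof.
elim: d => // d IH /=; apply/andP; split; first by apply/allpairsP => -[[l r] []].
by apply: allpairs_uniq => // -[l r] [l' r'] _ _ [-> ->].
Qed.

Section TreeSystem.
Variables (k : nat) (p : 'I_k -> bintree).

(** States live in [trees_upto d.+1] because [trees_upto e] holds the trees of height below [e]. *)
Let d := \max_(i < k) height (p i).
Let state := seq_sub (trees_upto d.+1).
Let state_of T : state := SeqSub (mem_prune d T).
Let join (s t : state) : state := state_of (Node (ssval s) (ssval t)).
Let weight (s : state) : {mpoly rat[k.+1]} :=
  \prod_(i < k) 'X_(lift ord0 i) ^+ matchb (p i) (ssval s).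

Lemma matchb_state i T : matchb (p i) (ssval (state_of T)) = matchb (p i) T.
Proof. by apply: matchb_prune; rewrite /d (bigD1 i) //= leq_maxl. Qed.

Lemma state_of_Node l r : state_of (Node l r) = join (state_of l) (state_of r).
Proof. by apply: val_inj; exact/esym/prune_Node. Qed.

Lemma tree_term_Leaf :
  tree_term p Leaf = fps_var rat ord0 * fps_of_mpoly (weight (state_of Leaf)).
Proof.
rewrite /tree_term expr1 rmorph_prod; congr (_ * _); apply: eq_bigr => i _.
by rewrite copies_Leaf matchb_state rmorphXn.
Qed.

Lemma tree_term_Node l r :
  tree_term p (Node l r) =
  fps_var rat ord0 * (fps_of_mpoly (weight (state_of (Node l r))) *
    (tree_term p l * tree_term p r)).
Proof.
rewrite /tree_term /nvertices /= size_cat !size_map exprS exprD.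
rewrite -mulrA; congr (_ * _).
have -> : \prod_(i < k) fps_var rat (lift ord0 i) ^+ copies (p i) (Node l r) =
    fps_of_mpoly (weight (state_of (Node l r))) *
    (\prod_(i < k) fps_var rat (lift ord0 i) ^+ copies (p i) l *
     \prod_(i < k) fps_var rat (lift ord0 i) ^+ copies (p i) r).
  rewrite rmorph_prod -!big_split; apply: eq_bigr => i _ /=.
  by rewrite copies_Node matchb_state !exprD -mulrA rmorphXn.
by rewrite [in RHS]mulrACA [RHS]mulrCA.
Qed.

(** Applying the system once more allows one more level: a leaf, or a root above two of the previous
    trees, grouped by state. *)
Lemma sum_tree_term_iter e s :
  \sum_(T <- trees_upto e | state_of T == s) tree_term p T =
  iter e (tree_system (state_of Leaf) join (fps_var rat ord0) 0
    (fun t => fps_of_mpoly (weight t))) (fun=> 0) s.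
Proof.
elim: e s => [|e IH] s; first by rewrite big_nil.
rewrite iterS; set G := iter e _ _; rewrite /tree_system mul0r addr0.
have -> : \sum_t \sum_u (join t u == s)%:R * (G t * G u) =
    \sum_(l <- trees_upto e) \sum_(r <- trees_upto e)
      (state_of (Node l r) == s)%:R * (tree_term p l * tree_term p r).
  rewrite [RHS](partition_big state_of predT) //=; apply: eq_bigr => t _.
  under [RHS]eq_bigr => l _ do rewrite (partition_big state_of predT) //=.
  rewrite exchange_big /=; apply: eq_bigr => u _.
  rewrite -[G t]IH -[G u]IH big_distrlr /= mulr_sumr; apply: eq_bigr => l /eqP <-.
  by rewrite mulr_sumr; apply: eq_bigr => r /eqP <-; rewrite state_of_Node.
rewrite big_mkcond /= big_cons big_allpairs_dep !mulrDr; congr (_ + _).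
  rewrite eq_sym; case: eqP => [->|_]; last by rewrite !mulr0.
  by rewrite tree_term_Leaf mulr1.
rewrite !mulr_sumr; apply: eq_bigr => l _; rewrite !mulr_sumr.
apply: eq_bigr => r _; case: eqP => [<-|_]; last by rewrite mul0r !mulr0.
by rewrite tree_term_Node mul1r.
Qed.

Lemma En_tree_system :
  En p = \sum_s fps_fix (tree_system (state_of Leaf) join (fps_var rat ord0) 0
    (fun t => fps_of_mpoly (weight t))) s.
Proof.
(* The trees counted at [m] have [m ord0] vertices, so [trees_upto (mdeg m).+1] contains them all,
   and this iterate agrees with the fixed point in degree [mdeg m]. *)
apply: fpsP => m; have md : (m ord0 <= (mdeg m).+1)%N.
  by rewrite mdegE big_ord_recl -addnS leq_addr.
rewrite (En_coef p md) undup_id ?trees_upto_uniq //.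
rewrite -fcoef_bigsum (partition_big state_of predT) //.
apply: (@fps_eqmod_sum _ _ (mdeg m).+1) (ltnSn _) => s m' m'd.
rewrite sum_tree_term_iter; apply/esym.
by apply: fps_fix_eqmod m'd; exact/tree_system_contracts/fcoef_var0.
Qed.

End TreeSystem.

Theorem theorem2 (k : nat) (k_ge1 : (1 <= k)%N) (p : 'I_k -> bintree) :
  fps_algebraic (En p).
Proof.
by rewrite En_tree_system; exact: fps_algebraic_tree_system.
Qed.
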